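(* Assume (HH1), (HH2), (HH3) of the context. Let $f:X\to X$ be a $C^0$ bundle map over $h$ (fiber maps $f_m:X_m\to X_{h(m)}$, $m\in M_1$). Assume that the fibers of $X$ are uniformly bounded, i.e. $\sup_m\operatorname{diam}X_m<\infty$, and that $\operatorname{Lip}f_m\le\lambda(m)$, where $\lambda:M\to\mathbb R_+$ is $\varepsilon$-almost uniformly continuous around $M_1$ and $\varepsilon$-almost continuous, and $\sup_m\lambda(m)<1$. If $\varepsilon$ is sufficiently small, then: (1) There is a unique section $\sigma:M\to X$ which is invariant under $f$ (i.e. $f_m(\sigma(m))=\sigma(h(m))$ for $m\in M_1$). Moreover $\sigma$ is $C^0$. (2) In addition, if $f_m$ depends in a uniformly Lipschitz fashion on the base point $m$ around $M_1$ (with respect to $\mathcal A$) and $\sup_m\mu^\theta(m)\lambda(m)<1$ (bunching condition), then $\sigma$ is uniformly (locally) $C^{0,\theta}$ around $M_1$.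
   Context: (HH1) $M$ is locally metrizable: a Hausdorff space with an open cover $\{U_m:m\in M\}$, $m\in U_m$, each $U_m$ carrying a metric $d_m$ inducing its subspace topology; $U_m(\epsilon)=\{m'\in U_m:d_m(m',m)<\epsilon\}$. $M_1\subset M$. (HH2) $(X,M,\pi)$ is a $C^0$ topology bundle with metric fibers: $\pi:X\to M$ is a surjection with fibers $X_m=\pi^{-1}(m)$ complete metric spaces, and there is an atlas of bundle charts $\varphi:U\times X_{m_0}\to X$, $(m,x)\mapsto(m,\varphi_m(x))$, $\varphi_m:X_{m_0}\to X_m$ bijective, with open domains $U$ covering $M$ and continuous transition maps (topologizing $X$). $\mathcal A=\{(U_{m_0}(\epsilon),\varphi^{m_0}):m_0\in M_1,0<\epsilon<\epsilon'\}$ consists of $C^0$ bundle charts at $m_0$ with $\varphi^{m_0}_{m_0}=\mathrm{id}$, and $\operatorname{Lip}(\varphi^{m_0}_m)^{\pm1}\le1+\eta(d_{m_0}(m,m_0))$, with $\eta:\mathbb R_+\to\mathbb R_+$ independent of $m_0$ and $\limsup_{\delta\to0}\eta(\delta)\le\varepsilon$, $\varepsilon>0$ small. (HH3) $h:M_1\to M$ is a $C^0$ invertible map, and there are $\varepsilon_1>0$ and $\mu:M\to\mathbb R_+$ such that for every $m_0\in M_1$, $h^{-1}(U_{m_0}(\mu^{-1}(m_0)\varepsilon_1))\subset U_{h^{-1}(m_0)}$ and $d_{h^{-1}(m_0)}(h^{-1}(m),h^{-1}(m_0))\le\mu(m_0)d_{m_0}(m,m_0)$ for $m\in U_{m_0}(\mu^{-1}(m_0)\varepsilon_1)$;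 and $\sup_{m_0\in M_1}\mu(m_0)<\infty$. A function $g:M\to\mathbb R$ is $\varepsilon$-almost uniformly continuous around $M_1$ if $\sup\{|g(m)-g(m_0)|:m\in U_{m_0}(\sigma),m_0\in M_1\}\le\varepsilon$ as $\sigma\to0$, and $\varepsilon$-almost continuous if for every $m_0\in M$, $\sup_{m\in U_{m_0}(\sigma)}|g(m)-g(m_0)|\le\varepsilon$ as $\sigma\to0$. $f_m$ depends in a uniformly Lipschitz fashion on $m$ around $M_1$: the local representations $\widehat f_{m_0}(m,x)=(\varphi^{m_0}_m)^{-1}f_{h^{-1}(m)}(\varphi^{h^{-1}(m_0)}_{h^{-1}(m)}(x))$, $U_{m_0}(\mu^{-1}(m_0)\varepsilon_1)\times X_{h^{-1}(m_0)}\to X_{m_0}$, $m_0\in M_1$, satisfy $|\widehat f_{m_0}(m,x)-\widehat f_{m_0}(m_0,x)|\le M_0d_{m_0}(m,m_0)$ with $M_0$ independent of $m_0$ and $x$. $\sigma$ is uniformly (locally) $C^{0,\theta}$ around $M_1$: the local representations $\widehat\sigma_{m_0}(m)=(\varphi^{m_0}_m)^{-1}(\sigma(m))$, $m\in U_{m_0}(\mu^{-1}(m_0)\varepsilon_1)$, satisfy $|\widehat\sigma_{m_0}(m)-\widehat\sigma_{m_0}(m_0)|\le C_0d_{m_0}(m,m_0)^\theta$ with $C_0>0$ independent of $m_0\in M_1$ (for $m$ near $m_0$, uniformly in $m_0$); here $0<\theta\le1$. *)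

(* Defs.v *)
From HB Require Import structures.
From mathcomp Require Import all_boot all_order all_algebra.
From mathcomp Require Import all_classical all_reals all_analysis.
Set Implicit Arguments.
Unset Strict Implicit.
Unset Printing Implicit Defensive.
Import Order.TTheory GRing.Theory Num.Theory.
Import numFieldNormedType.Exports.
Local Open Scope classical_set_scope.
Local Open Scope ring_scope.

#[short(type="completeMetricType")]
HB.structure Definition CompleteMetric (K : numDomainType) :=
  { T of Metric K T & Complete T }.

Definition diam (R : realType) (T : metricType R) : \bar R :=
  ereal_sup [set (mdist p.1 p.2)%:E | p in [set: T * T]].

(* [Lip g <= k] *)
Definition lip_le (R : realType) (S T : metricType R) (k : R) (g : S -> T) :=
  forall x y : S, mdist (g x) (g y) <= k * mdist x y.

(** Locally metrizable spaces *)

Definition metric_on (R : realType) (T : Type) (D : set T) (d : T -> T -> R) :=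
  [/\ forall x y, D x -> D y -> 0 <= d x y,
      forall x y, D x -> D y -> (d x y = 0 <-> x = y),
      forall x y, D x -> D y -> d x y = d y x
    & forall x y z, D x -> D y -> D z -> d x z <= d x y + d y z].

Definition induces_subspace_topology (R : realType) (M : topologicalType)
    (D : set M) (d : M -> M -> R) :=
  forall x, D x -> forall V : set M,
    within D (nbhs x) V <->
    exists2 e : R, 0 < e & forall y, D y -> d y x < e -> V y.

Definition locally_metrized (R : realType) (M : topologicalType)
    (U : M -> set M) (d : M -> M -> M -> R) :=
  hausdorff_space M /\
  forall m, [/\ open (U m), U m m, metric_on (U m) (d m)
              & induces_subspace_topology (U m) (d m)].

Definition lball (R : realType) (M : Type) (U : M -> set M)
    (d : M -> M -> M -> R) (m : M) (e : R) : set M :=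
  [set m' | U m m' /\ d m m' m < e].

(** C^0 topology bundles with metric fibers *)

(* [cmap m] is the fiber map [phi_m] and [cinv m] its inverse; both are only
   meaningful for [m] in [cdom]. *)
Record chart (R : realType) (M : topologicalType)
    (F : M -> completeMetricType R) := Chart {
  cbase : M ;
  cdom : set M ;
  cmap : forall m, F cbase -> F m ;
  cinv : forall m, F m -> F cbase }.

Arguments cmap {R M F} c m _ : rename.
Arguments cinv {R M F} c m _ : rename.

Definition bundle_chart (R : realType) (M : topologicalType)
    (F : M -> completeMetricType R) (c : chart F) :=
  open (cdom c) /\
  forall m, cdom c m ->
    cancel (cmap c m) (cinv c m) /\ cancel (cinv c m) (cmap c m).

(* [(m, x) |-> (phi'_m)^-1 (phi_m x)] is continuous on the common domain. *)
Definition continuous_transition (R : realType) (M : topologicalType)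
    (F : M -> completeMetricType R) (c c' : chart F) :=
  {within [set p : M * F (cbase c) | cdom c p.1 /\ cdom c' p.1],
    continuous (fun p => cinv c' p.1 (cmap c p.1 p.2))}.

Definition bundle_atlas (R : realType) (M : topologicalType)
    (F : M -> completeMetricType R) (A : set (chart F)) :=
  [/\ forall c, A c -> bundle_chart c,
      forall m, exists2 c, A c & cdom c m
    & forall c c', A c -> A c' -> continuous_transition c c'].

(* Bundle charts that may be added to the atlas. *)
Definition C0_chart (R : realType) (M : topologicalType)
    (F : M -> completeMetricType R) (A : set (chart F)) (c : chart F) :=
  bundle_chart c /\
  forall c', A c' -> continuous_transition c c' /\ continuous_transition c' c.

(* The total space [X] is the disjoint union of the fibers as a set, but its
   topology is the one defined by the atlas (not that of the disjoint union):
   [W] is open iff its preimage by [(m, x) |-> (m, phi_m x)] is open in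
   [U * X_m0] for every chart of the atlas. *)
Definition total_space (R : realType) (M : topologicalType)
    (F : M -> completeMetricType R) (A : set (chart F)) : Type :=
  {m : M & F m}.

HB.instance Definition _ (R : realType) (M : topologicalType)
    (F : M -> completeMetricType R) (A : set (chart F)) :=
  Choice.copy (total_space A) {m : M & F m}.

Definition in_fiber (R : realType) (M : topologicalType)
    (F : M -> completeMetricType R) (A : set (chart F)) (m : M) (x : F m) :
  total_space A := existT (fun m => F m) m x.

Definition total_proj (R : realType) (M : topologicalType)
    (F : M -> completeMetricType R) (A : set (chart F)) (p : total_space A) : M :=
  projT1 p.

Definition total_open (R : realType) (M : topologicalType)
    (F : M -> completeMetricType R) (A : set (chart F)) (W : set (total_space A)) :=
  forall c, A c ->
    @open (subspace [set p : M * F (cbase c) | cdom c p.1])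
      [set p | W (in_fiber A (cmap c p.1 p.2))].

Lemma total_openT (R : realType) (M : topologicalType)
    (F : M -> completeMetricType R) (A : set (chart F)) :
  total_open [set: total_space A].
Proof. by move=> c _; exact: openT. Qed.

Lemma total_openI (R : realType) (M : topologicalType)
    (F : M -> completeMetricType R) (A : set (chart F)) :
  setI_closed (@total_open R M F A).
Proof. by move=> V W oV oW c Ac; apply: openI; [exact: oV|exact: oW]. Qed.

Lemma total_open_bigU (R : realType) (M : topologicalType)
    (F : M -> completeMetricType R) (A : set (chart F))
    (I : Type) (W : I -> set (total_space A)) :
  (forall i, total_open (W i)) -> total_open (\bigcup_i W i).
Proof.
by move=> oW c Ac; apply: (@bigcup_open _ I setT) => i _; exact: oW.
Qed.

HB.instance Definition _ (R : realType) (M : topologicalType)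
    (F : M -> completeMetricType R) (A : set (chart F)) :=
  isOpenTopological.Build (total_space A)
    (@total_openT R M F A) (@total_openI R M F A) (@total_open_bigU R M F A).

(* The family [(lball U d m0 e, phi m0)], [m0] in [M1], [0 < e < eps'], of C^0
   charts at the points of [M1], with [psi m0 m] the inverse of [phi m0 m]. *)
Definition almost_isometric_charts (R : realType) (M : topologicalType)
    (F : M -> completeMetricType R) (A : set (chart F))
    (U : M -> set M) (d : M -> M -> M -> R) (M1 : set M)
    (eps' : R) (phi : forall m0 m : M, F m0 -> F m)
    (psi : forall m0 m : M, F m -> F m0) (eta : R -> R) (eps : R) :=
  [/\ 0 < eps',
      forall m0 e, M1 m0 -> 0 < e < eps' ->
        C0_chart A (@Chart R M F m0 (lball U d m0 e) (phi m0) (psi m0)),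
      forall m0, M1 m0 -> phi m0 m0 = id,
      forall m0 m, M1 m0 -> lball U d m0 eps' m ->
        lip_le (1 + eta (d m0 m m0)) (phi m0 m) /\
        lip_le (1 + eta (d m0 m m0)) (psi m0 m)
    & (forall t, 0 <= t -> 0 <= eta t) /\
      (limf_esup (fun t => (eta t)%:E) 0^'+ <= eps%:E)%E].

(** The base map *)

(* [h] is defined on [M1] only: its values elsewhere are irrelevant. *)
Definition C0_invertible (M : topologicalType) (M1 : set M) (h hinv : M -> M) :=
  [/\ forall m, M1 (hinv m), {in M1, cancel h hinv}, cancel hinv h,
      {within M1, continuous h} & continuous hinv].

Definition inverse_locally_lipschitz (R : realType) (M : topologicalType)
    (U : M -> set M) (d : M -> M -> M -> R) (M1 : set M) (hinv : M -> M)
    (eps1 : R) (mu : M -> R) :=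
  [/\ 0 < eps1,
      (forall m, 0 <= mu m) /\ (forall m, M1 m -> 0 < mu m),
      forall m0, M1 m0 ->
        hinv @` lball U d m0 ((mu m0)^-1 * eps1) `<=` U (hinv m0) /\
        forall m, lball U d m0 ((mu m0)^-1 * eps1) m ->
          d (hinv m0) (hinv m) (hinv m0) <= mu m0 * d m0 m m0
    & (ereal_sup [set (mu m)%:E | m in M1] < +oo)%E].

(** Almost continuity of real functions *)

Definition almost_uniformly_continuous_around (R : realType) (M : Type)
    (U : M -> set M) (d : M -> M -> M -> R) (M1 : set M) (eps : R)
    (g : M -> R) :=
  (limf_esup (fun s : R =>
     ereal_sup [set z | exists m0 m, [/\ M1 m0, lball U d m0 s m
                                       & z = `|g m - g m0|%:E]])
   0^'+ <= eps%:E)%E.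

Definition almost_continuous (R : realType) (M : Type)
    (U : M -> set M) (d : M -> M -> M -> R) (eps : R) (g : M -> R) :=
  forall m0,
  (limf_esup (fun s : R =>
     ereal_sup [set `|g m - g m0|%:E | m in lball U d m0 s])
   0^'+ <= eps%:E)%E.

(** Bundle maps and sections *)

(* Only the fiber maps [f m] with [m] in [M1] are relevant. *)
Definition bundle_map (R : realType) (M : topologicalType)
    (F : M -> completeMetricType R) (A : set (chart F)) (h : M -> M)
    (f : forall m, F m -> F (h m)) (p : total_space A) : total_space A :=
  in_fiber A (f (projT1 p) (projT2 p)).

Definition C0_bundle_map (R : realType) (M : topologicalType)
    (F : M -> completeMetricType R) (A : set (chart F)) (M1 : set M)
    (h : M -> M) (f : forall m, F m -> F (h m)) :=
  {within @total_proj R M F A @^-1` M1, continuous (@bundle_map R M F A h f)}.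

Definition section_map (R : realType) (M : topologicalType)
    (F : M -> completeMetricType R) (A : set (chart F))
    (sigma : forall m, F m) (m : M) : total_space A := in_fiber A (sigma m).

Definition invariant_section (R : realType) (M : topologicalType)
    (F : M -> completeMetricType R) (M1 : set M)
    (h : M -> M) (f : forall m, F m -> F (h m)) (sigma : forall m, F m) :=
  forall m, M1 m -> f m (sigma m) = sigma (h m).

(* [(phi^m0_m)^-1 o f_(h^-1 m) o phi^(h^-1 m0)_(h^-1 m)]; the fiber over [m] is
   written as the fiber over [h (hinv m)]. *)
Definition local_rep_map (R : realType) (M : topologicalType)
    (F : M -> completeMetricType R)
    (phi : forall m0 m : M, F m0 -> F m) (psi : forall m0 m : M, F m -> F m0)
    (h hinv : M -> M) (f : forall m, F m -> F (h m))
    (m0 m : M) (x : F (hinv m0)) : F m0 :=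
  psi m0 (h (hinv m)) (f (hinv m) (phi (hinv m0) (hinv m) x)).

Arguments local_rep_map {R M F} phi psi {h} hinv f m0 m x.

(* The local representation at [m0] is considered at those [m] for which the
   charts it involves are defined. *)
Definition uniformly_lipschitz_map_around (R : realType) (M : topologicalType)
    (F : M -> completeMetricType R)
    (U : M -> set M) (d : M -> M -> M -> R) (M1 : set M) (eps' : R)
    (phi : forall m0 m : M, F m0 -> F m) (psi : forall m0 m : M, F m -> F m0)
    (h hinv : M -> M) (eps1 : R) (mu : M -> R)
    (f : forall m, F m -> F (h m)) :=
  exists L : R, forall m0 m, M1 m0 ->
    lball U d m0 ((mu m0)^-1 * eps1) m ->
    lball U d m0 eps' m -> lball U d (hinv m0) eps' (hinv m) ->
    forall x : F (hinv m0),
      mdist (local_rep_map phi psi hinv f m0 m x)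
            (local_rep_map phi psi hinv f m0 m0 x) <= L * d m0 m m0.

(* [r] makes precise "for [m] near [m0], uniformly in [m0]". *)
Definition uniformly_holder_section_around (R : realType)
    (M : topologicalType) (F : M -> completeMetricType R)
    (U : M -> set M) (d : M -> M -> M -> R) (M1 : set M) (eps' : R)
    (psi : forall m0 m : M, F m -> F m0) (eps1 : R) (mu : M -> R)
    (theta : R) (sigma : forall m, F m) :=
  exists C r : R, [/\ 0 < C, 0 < r & forall m0 m, M1 m0 ->
    lball U d m0 ((mu m0)^-1 * eps1) m -> lball U d m0 eps' m ->
    d m0 m m0 < r ->
    mdist (psi m0 m (sigma m)) (psi m0 m0 (sigma m0)) <=
      C * (d m0 m m0) `^ theta].

(* Main.v *)
Require Import Defs.
From HB Require Import structures.
From mathcomp Require Import all_boot all_order all_algebra.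
From mathcomp Require Import all_classical all_reals all_analysis.
From mathcomp Require Import ring lra.
Set Implicit Arguments.
Unset Strict Implicit.
Unset Printing Implicit Defensive.
Import Order.TTheory GRing.Theory Num.Theory.
Import numFieldNormedType.Exports.
Local Open Scope classical_set_scope.
Local Open Scope ring_scope.

(* Since [h] is invertible onto [M], invariance of [sigma] means that
   [sigma m = f_(h^-1 m) (sigma (h^-1 m))] for all [m]: [sigma] is the fixed
   point of a contraction of the space of all sections.

   Continuity at [m0] in [M1]: let [D m0 m] be the distance from [sigma m] to
   [sigma m0], read in the chart at [m0]. Invariance and the continuity of [f]
   give [D m0 m <= q * D (h^-1 m0) (h^-1 m) + o(1)] as [m] tends to [m0], where
   [q < 1] is the contraction rate times the distortion of two charts. As [D] is
   bounded by the diameter of the fibers, iterating gives [D m0 m = o(1)]. The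
   remaining points follow from [sigma = f o sigma o h^-1].

   Hoelder regularity: interpolating through [f_(h^-1 m0)] applied to the local
   representative of [sigma (h^-1 m)], the same comparison reads
   [D m0 m <= L * d m m0 + lambda (h^-1 m0) * D (h^-1 m0) (h^-1 m)], with no
   distortion factor, so the bunching condition suffices without any further
   smallness of [eps]. *)

(** * Invariant sections as fixed points of a contraction *)

Lemma expr_bound_eventually_small (R : realType) (q B e : R) :
  0 <= q -> q < 1 -> 0 < e -> \forall n \near \oo, q ^+ n * B < e.
Proof.
move=> q0 q1 e0.
have /cvgrPdist_lt/(_ e e0) : (q ^+ n * B @[n --> \oo] --> 0 * B).
  by apply: cvgMl; apply: cvg_expr; rewrite ger0_norm.
rewrite mul0r; apply: filterS => n; rewrite sub0r normrN.
exact: le_lt_trans (ler_norm _).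
Qed.

Lemma le_of_geometric_error (R : realType) (q B x y : R) : 0 <= q -> q < 1 ->
  (forall n, x <= y + q ^+ n * B) -> x <= y.
Proof.
move=> q0 q1 H; apply/ler_addgt0Pr => e e0.
have [n _ /(_ n (leqnn n)) /= ne] := expr_bound_eventually_small B q0 q1 e0.
by rewrite (le_trans (H n))// lerD2l ltW.
Qed.

(** The transform [T] contracts by [q] the uniform distance between sections, which is at most [B].
    Iterates of any two sections are thus within [q ^+ n * B] of each other in every fiber, and
    completeness is only used fiber by fiber. *)
Lemma exists_unique_fixed_section (R : realType) (M : Type)
    (F : M -> completeMetricType R) (k : M -> M)
    (g : forall m, F (k m) -> F m) (q B : R) : 0 <= q -> q < 1 ->
  (forall m (x y : F m), mdist x y <= B) ->
  (forall m, lip_le q (g m)) ->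
  exists! sigma : forall m, F m, forall m, g m (sigma (k m)) = sigma m.
Proof.
move=> q0 q1 diamF lipg.
pose T (s : forall m, F m) m := g m (s (k m)).
have TB n s t m : mdist (iter n T s m) (iter n T t m) <= q ^+ n * B.
  elim: n m => [|n IH] m /=; first by rewrite expr0 mul1r.
  by rewrite exprS -mulrA (le_trans (lipg _ _ _))//; exact: ler_wpM2l.
have fix_iter s : T s = s -> forall n, iter n T s = s.
  by move=> Ts; elim=> //= n ->.
pose u n := iter n T (fun m => point).
have uB n j m : mdist (u n m) (u (n + j)%N m) <= q ^+ n * B.
  by rewrite /u iterD; exact: TB.
have cvgu m : cvg (u n m @[n --> \oo]).
  apply: cauchy_cvg; apply: cauchy_exP => e e0.
  have [n _ nP] := expr_bound_eventually_small B q0 q1 e0.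
  exists (u n m); exists n => // j /= nj; rewrite ballEmdist /=.
  by rewrite -(subnKC nj) (le_lt_trans (uB _ _ _))//; exact: nP (leqnn n).
pose s m : F m := lim (u n m @[n --> \oo]).
have sB m n : mdist (u n m) (s m) <= q ^+ n * B.
  apply/ler_addgt0Pr => e e0.
  have [j _ /(_ (n + j)%N (leq_addl _ _)) /= jP] :=
    metricType_numDomainType.cvgr_dist_lt (cvgu m) e0.
  rewrite (le_trans (metric_triangle _ (u (n + j)%N m) _))// lerD//.
  by rewrite metric_sym ltW.
(* Both sides are within [q * (q ^+ n * B)] of [u n.+1 m]. *)
have sP m : g m (s (k m)) = s m.
  apply: mdist_positivity; apply/eqP; rewrite eq_le mdist_ge0 andbT.
  apply: (@le_of_geometric_error _ q (q * B + q * B)) => // n.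
  rewrite add0r mulrDr mulrA -exprSr.
  rewrite (le_trans (metric_triangle _ (u n.+1 m) _))// lerD//.
  rewrite metric_sym (le_trans (lipg _ _ _))//.
  by rewrite exprS -mulrA; exact: ler_wpM2l.
exists s; split => // t tP; apply: functional_extensionality_dep => m.
  apply: mdist_positivity; apply/eqP; rewrite eq_le mdist_ge0 andbT.
  apply: (@le_of_geometric_error _ q B) => // n; rewrite add0r.
  by have := TB n s t m; rewrite !fix_iter//; exact: functional_extensionality_dep.
Qed.

(** The values of [f (hinv m)] lie over [h (hinv m)], which equals [m] only propositionally, so [g]
    transports them along [hinvK]. Transport is isometric, hence [g] is again a family of
    contractions. *)
Lemma exists_unique_invariant_section (R : realType) (M : topologicalType)
    (F : M -> completeMetricType R) (M1 : set M) (h hinv : M -> M)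
    (f : forall m, F m -> F (h m)) (q B : R) : 0 <= q -> q < 1 ->
  (forall m, M1 (hinv m)) -> {in M1, cancel h hinv} ->
  forall hinvK : cancel hinv h,
  (forall m (x y : F m), mdist x y <= B) ->
  (forall m, M1 m -> lip_le q (f m)) ->
  exists! sigma : forall m, F m, invariant_section M1 f sigma.
Proof.
move=> q0 q1 M1hinv hK hinvK diamF lipf.
pose g m (x : F (hinv m)) : F m :=
  eq_rect (h (hinv m)) F (f (hinv m) x) m (hinvK m).
have lipg m : lip_le q (g m).
  have transport_dist a b (e : a = b) (x y : F a) :
      mdist (eq_rect a F x b e) (eq_rect a F y b e) = mdist x y.
    by case: _ / e.
  by move=> x y; rewrite /g transport_dist; exact: lipf.
have fixedE s : (forall m, g m (s (hinv m)) = s m) <-> invariant_section M1 f s.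
  split=> [gs m M1m|fs m].
    (* Generalizing the proof [hinvK (h m)] allows [hinv (h m)] to be rewritten to [m]; it then
       proves [h m = h m] and the transport is trivial. *)
    rewrite -(gs (h m)) /g; move: (hinvK (h m)).
    rewrite (hK m); last exact: mem_set.
    by move=> e; rewrite (Prop_irrelevance e erefl).
  have transport_section a b (e : a = b) : eq_rect a F (s a) b e = s b.
    by case: _ / e.
  by rewrite /g fs.
have [s [sP s_uniq]] :=
  @exists_unique_fixed_section _ _ _ hinv g _ _ q0 q1 diamF lipg.
exists s; split; first exact/fixedE.
by move=> t /fixedE; exact: s_uniq.
Qed.

(** * Continuity in the total space, read in charts *)

Lemma fst_continuous (S T : topologicalType) : continuous (@fst S T).
Proof. by move=> p; exact: cvg_fst. Qed.

Section charts.
Context {R : realType} {M : topologicalType} {F : M -> completeMetricType R}.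
Variable A : set (chart F).
Hypothesis atlasA : bundle_atlas A.
Implicit Types c : chart F.

Lemma transition_continuous_at c c' m (x : F (cbase c)) :
  bundle_chart c -> bundle_chart c' -> continuous_transition c c' ->
  cdom c m -> cdom c' m ->
  {for (m, x), continuous (fun p => cinv c' p.1 (cmap c p.1 p.2))}.
Proof.
move=> [oc _] [oc' _]; rewrite /continuous_transition.
have fstc := @fst_continuous M (F (cbase c)).
have oD : open [set p : M * F (cbase c) | cdom c p.1 /\ cdom c' p.1].
  by apply: openI; move/continuousP : fstc; apply.
by rewrite continuous_open_subspace// => cc' cm c'm; apply: cc'; rewrite inE.
Qed.

Lemma near_chart_domain c m : bundle_chart c -> cdom c m ->
  \forall m' \near m, cdom c m'.
Proof. by move=> [oc _] cm; exact: open_nbhs_nbhs. Qed.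

(** Open sets of the total space are tested on charts of [A], to which [c] may not belong: pass to a
    chart [c'] of [A] around [m] and use the transition from [c] to [c']. *)
Lemma chart_continuous_at c m (x : F (cbase c)) :
  C0_chart A c -> cdom c m ->
  {for (m, x), continuous (fun p => in_fiber A (cmap c p.1 p.2))}.
Proof.
move=> [bc trc] cm W; rewrite nbhsE => -[V [oV Vx] VW].
have [bA /(_ m)[c' Ac' c'm] _] := atlasA.
have bc' := bA _ Ac'.
pose D := [set p : M * F (cbase c') | cdom c' p.1].
pose V' := [set p : M * F (cbase c') | V (in_fiber A (cmap c' p.1 p.2))].
have oD : open D.
  by move/continuousP : (@fst_continuous M (F (cbase c'))); apply; case: bc'.
have oDV' : open (D `&` V').
  by rewrite open_setSI//; exact: (oV c' Ac').
have trc' := transition_continuous_at (x := x) bc bc' (trc c' Ac').1 cm c'm.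
have fst1 : p.1 @[p --> (m, x)] --> m by exact: cvg_fst.
have cvg_tr : (p.1, cinv c' p.1 (cmap c p.1 p.2)) @[p --> (m, x)] -->
    (m, cinv c' m (cmap c m x)) by exact: cvg_pair.
have nDV' : nbhs (m, cinv c' m (cmap c m x)) (D `&` V').
  apply: open_nbhs_nbhs; split => //; split => //=.
  by rewrite /V'/= (bc'.2 m c'm).2.
have : nbhs (m, x) [set p | (D `&` V') (p.1, cinv c' p.1 (cmap c p.1 p.2))].
  exact: cvg_tr _ nDV'.
apply: (@filterS _ (nbhs (m, x))) => p [/= c'p V'p].
by apply: VW; move: V'p; rewrite /V'/= (bc'.2 _ c'p).2.
Qed.

(** Read in a chart [c'] of [A], the preimage [W] of an open set is its preimage under the
    transition from [c'] to [c]. *)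
Lemma chart_coordinate_continuous_at c (p : total_space A) :
  C0_chart A c -> cdom c (total_proj p) ->
  {for p, continuous (fun p : total_space A => cinv c (projT1 p) (projT2 p))}.
Proof.
move=> [bc trc] cp V; rewrite nbhsE => -[V0 [oV0 V0x] V0V].
have [bA _ _] := atlasA.
pose W : set (total_space A) :=
  [set p | cdom c (projT1 p) /\ V0 (cinv c (projT1 p) (projT2 p))].
suff oW : open W by apply: (@filterS _ _ _ W) => [q [_ /V0V]//|]; exact: open_nbhs_nbhs.
move=> c' Ac'; have bc' := bA _ Ac'.
rewrite -open_setSI; last first.
  by move/continuousP : (@fst_continuous M (F (cbase c'))); apply; case: bc'.
rewrite openE => -[m x] [/= c'm [/= cm V0m]].
have tr := transition_continuous_at (x := x) bc' bc (trc c' Ac').2 c'm cm.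
have n1 := tr _ (open_nbhs_nbhs (conj oV0 V0m)).
have n2 : \forall p \near (m, x), cdom c p.1.
  by apply: (@cvg_fst _ _ (nbhs m) (nbhs x)); exact: near_chart_domain.
have n3 : \forall p \near (m, x), cdom c' p.1.
  by apply: (@cvg_fst _ _ (nbhs m) (nbhs x)); exact: near_chart_domain.
rewrite /interior; near=> q; split => /=; first by near: q.
by split => /=; near: q.
Unshelve. all: by end_near. Qed.

Lemma section_continuous_at c (sigma : forall m, F m) m :
  C0_chart A c -> cdom c m ->
  {for m, continuous (fun m => cinv c m (sigma m))} ->
  {for m, continuous (section_map A sigma)}.
Proof.
move=> cc cm sm; have [bc _] := cc.
have ct := chart_continuous_at (x := cinv c m (sigma m)) cc cm.
have : in_fiber A (cmap c m' (cinv c m' (sigma m'))) @[m' --> m] -->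
    in_fiber A (cmap c m (cinv c m (sigma m))).
  have pair_cvg : (m', cinv c m' (sigma m')) @[m' --> m] -->
      (m, cinv c m (sigma m)).
    by apply: cvg_pair; [exact: cvg_id|exact: sm].
  exact: (cvg_comp _ (fun p => in_fiber A (cmap c p.1 p.2)) pair_cvg ct).
rewrite /continuous_at /section_map (bc.2 m cm).2.
apply: cvg_trans; apply: near_eq_cvg.
apply: filterS (near_chart_domain bc cm) => m' c'm.
by rewrite /= (bc.2 m' c'm).2.
Qed.

End charts.

(** * From a one-step recursion to a Hoelder bound *)

Lemma le_powR_rescale (R : realType) (theta rho x : R) :
  theta <= 1 -> 0 <= x -> x <= rho -> x <= rho `^ (1 - theta) * x `^ theta.
Proof.
move=> theta1 x0 xrho; have [->|x_neq0] := eqVneq x 0.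
  by rewrite mulr_ge0 ?powR_ge0.
have {1}-> : x = x `^ (1 - theta) * x `^ theta.
  by rewrite -powRD ?x_neq0 ?implybT// subrK powRr1.
rewrite ler_wpM2r ?powR_ge0//.
by rewrite ge0_ler_powR// ?nnegrE ?subr_ge0//; exact: le_trans xrho.
Qed.

(** Induction on [n] gives the bound with weight [w m0] up to an error [lb ^+ n * B], which vanishes
    in the limit. Pairs at distance at least [rho] satisfy it because [D] is bounded, so orbits
    under [k] may leave the region where the recursion holds. *)
Lemma holder_of_recursion (R : realType) (M : Type) (U : M -> set M)
    (d : M -> M -> M -> R) (M1 : set M) (k : M -> M) (mu lambda : M -> R)
    (D : M -> M -> R) (theta rho L B lb kappa Lambda : R) :
  0 < theta -> theta <= 1 -> 0 < rho -> 0 <= L -> 0 <= B ->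
  lb < 1 -> kappa < 1 ->
  (forall m, M1 (k m)) ->
  (forall m, M1 m -> [/\ 0 <= mu m, mu m <= Lambda, 0 <= lambda m,
    lambda m <= lb & mu m `^ theta * lambda m <= kappa]) ->
  (forall m0 m, M1 m0 -> U m0 m -> 0 <= d m0 m m0) ->
  (forall m0 m, D m0 m <= B) ->
  (forall m0 m, M1 m0 -> U m0 m -> d m0 m m0 < rho ->
    [/\ U (k m0) (k m), d (k m0) (k m) (k m0) <= mu m0 * d m0 m m0
      & D m0 m <= L * d m0 m m0 + lambda (k m0) * D (k m0) (k m)]) ->
  exists2 C, 0 < C & forall m0 m, M1 m0 -> U m0 m ->
    D m0 m <= C * d m0 m m0 `^ theta.
Proof.
move=> theta0 theta1 rho0 L0 B0 lb1 kappa1 M1k bounds d0 DB step.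
(* The first summand of [S] turns the Lipschitz term into a Hoelder one at distances below [rho];
   the second dominates [B] at larger distances. [K] solves [K * kappa + S = K]. *)
pose S := L * rho `^ (1 - theta) + B / rho `^ theta.
pose K := S / (1 - kappa).
(* [w] satisfies [lambda (k m) * w (k m) <= K], which absorbs the factor
   [mu m `^ theta] lost in one step: the bunching condition pairs [mu] and
   [lambda] at the same point, whereas a step pairs [mu m] with
   [lambda (k m)]. *)
pose w m := K * mu m `^ theta + S.
have rho_theta : 0 < rho `^ theta by rewrite powR_gt0.
have S0 : 0 <= S by rewrite /S addr_ge0 ?mulr_ge0 ?invr_ge0 ?powR_ge0.
have K0 : 0 <= K by rewrite /K divr_ge0//; lra.
have KS : K * kappa + S = K by rewrite /K; field; lra.
have w0 m : 0 <= w m by exact: addr_ge0 (mulr_ge0 K0 (powR_ge0 _ _)) S0.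
have lw m : M1 m -> lambda m * w m <= K.
  move=> /bounds[_ _ l0 llb muk].
  have -> : lambda m * w m = K * (mu m `^ theta * lambda m) + lambda m * S.
    by rewrite /w; ring.
  rewrite -[leRHS]KS lerD ?ler_wpM2l// ler_piMl//; lra.
have approx n m0 m : M1 m0 -> U m0 m ->
    D m0 m <= w m0 * d m0 m m0 `^ theta + lb ^+ n * B.
  elim: n m0 m => [|n IH] m0 m M1m0 Um.
    by rewrite expr0 mul1r (le_trans (DB _ _))// lerDr mulr_ge0 ?powR_ge0.
  have lb0 : 0 <= lb by have [_ _ l0 llb _] := bounds _ M1m0; lra.
  have dm0 := d0 _ _ M1m0 Um.
  have [rho_d|d_rho] := leP rho (d m0 m m0).
    rewrite (le_trans (DB _ _))// ler_wpDr ?mulr_ge0 ?exprn_ge0//.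
    rewrite (@le_trans _ _ (B / rho `^ theta * d m0 m m0 `^ theta))//.
      rewrite -mulrA ler_peMr// mulrC ler_pdivlMr// mul1r.
      by rewrite ge0_ler_powR// ?nnegrE// ltW.
    rewrite ler_wpM2r ?powR_ge0// /w /S addrA lerDr addr_ge0//.
      exact: mulr_ge0 K0 (powR_ge0 _ _).
    exact: mulr_ge0 L0 (powR_ge0 _ _).
  have [Ukm dkm Dm] := step _ _ M1m0 Um d_rho.
  have [mu0 _ _ _ _] := bounds _ M1m0.
  have [_ _ l0 llb _] := bounds _ (M1k m0).
  have dk0 := d0 _ _ (M1k m0) Ukm.
  have pow_k : d (k m0) (k m) (k m0) `^ theta <= mu m0 `^ theta * d m0 m m0 `^ theta.
    by rewrite -powRM// ge0_ler_powR ?nnegrE ?mulr_ge0// ltW.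
  have Ld : L * d m0 m m0 <= S * d m0 m m0 `^ theta.
    rewrite (le_trans (ler_wpM2l L0 (le_powR_rescale theta1 dm0 (ltW d_rho))))//.
    by rewrite mulrA ler_wpM2r ?powR_ge0// /S lerDl mulr_ge0 ?invr_ge0 ?powR_ge0.
  rewrite (le_trans Dm)// /w mulrDl [K * _ * _ + _]addrC -addrA lerD//.
  rewrite (le_trans (ler_wpM2l l0 (IH _ _ (M1k m0) Ukm)))// mulrDr lerD//.
    rewrite mulrA (le_trans (ler_wpM2r (powR_ge0 _ _) (lw _ (M1k m0))))//.
    by rewrite -mulrA ler_wpM2l.
  by rewrite exprS -mulrA ler_wpM2r// mulr_ge0// exprn_ge0.
(* Nonnegativity of [lb] is read off at a point of [M1]; if there is none, any positive constant
   will do. *)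
have [[m1 M1m1]|noM1] := pselect (exists m, M1 m); last first.
  by exists 1 => // m0 m M1m0; exfalso; apply: noM1; exists m0.
have lb0 : 0 <= lb by have [_ _ l0 llb _] := bounds _ M1m1; lra.
(* [Lambda] makes the weight uniform in [m0]; the summand 1 makes the constant positive. *)
exists (K * Lambda `^ theta + S + 1).
  by rewrite ltr_wpDl// addr_ge0//; exact: mulr_ge0 K0 (powR_ge0 _ _).
move=> m0 m M1m0 Um.
rewrite (le_trans (le_of_geometric_error lb0 lb1 (fun n => approx n m0 m M1m0 Um)))//.
rewrite ler_wpM2r ?powR_ge0// ler_wpDr// /w lerD2r ler_wpM2l//.
have [mu0 muL _ _ _] := bounds _ M1m0.
by rewrite ge0_ler_powR ?nnegrE ?(ltW theta0) ?(le_trans mu0 muL).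
Qed.

(** The limit superior is an infimum of suprema over right neighborhoods of 0, and the strict
    inequality selects one of them. *)
Lemma limf_esup_right_bound (R : realType) (g : R -> R) (a b : R) :
  (limf_esup (fun t => (g t)%:E) 0^'+ <= a%:E)%E -> a < b ->
  exists2 r : R, 0 < r & forall t, 0 < t -> t < r -> g t <= b.
Proof.
move=> ga ab.
have : (limf_esup (fun t => (g t)%:E) 0^'+ < b%:E)%E.
  by rewrite (le_lt_trans ga)// lte_fin.
rewrite limf_esupE => /ereal_inf_lt [_ [V V0 <-] /ltW supV].
have [r /= r0 rV] : nbhs_ball (0 : R) [set t | 0 < t -> V t] by exact/nbhs_ballP.
exists r => // t t0 tr; rewrite -lee_fin (le_trans _ supV)//.
apply: ereal_sup_ubound; exists t => //; apply: rV => //.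
by rewrite /ball/= sub0r normrN gtr0_norm.
Qed.

(** * Charts at the points of [M1] and regularity of an invariant section *)

Section invariant_sections.
Context {R : realType} {M : topologicalType}.
Context {U : M -> set M} {d : M -> M -> M -> R}.
Hypothesis Ud : locally_metrized U d.

Lemma near_lball m e : 0 < e -> \forall m' \near m, lball U d m e m'.
Proof.
move=> e0; have [oU Um _ /(_ _ Um)] := Ud.2 m.
move=> /(_ [set m' | d m m' m < e]) [_ H].
have : within (U m) (nbhs m) [set m' | d m m' m < e] by apply: H; exists e.
rewrite /within /=; apply: (@filterS2 _ (nbhs m)) (open_nbhs_nbhs (conj oU Um)).
by move=> m' Um' /(_ Um').
Qed.

Lemma local_dist_ge0 m m' : U m m' -> 0 <= d m m' m.
Proof. by have [_ Um [d0 _ _ _] _] := Ud.2 m => Um'; exact: d0. Qed.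

Lemma local_distxx m : d m m m = 0.
Proof. by have [_ Um [_ d0 _ _] _] := Ud.2 m; apply/d0. Qed.

Lemma local_dist_eq0 m m' : U m m' -> d m m' m = 0 -> m' = m.
Proof. by have [_ Um [_ d0 _ _] _] := Ud.2 m => Um' /d0; exact. Qed.

Lemma lballxx m e : 0 < e -> lball U d m e m.
Proof. by have [_ Um _ _] := Ud.2 m; rewrite /lball/= local_distxx. Qed.

Context {M1 : set M} {F : M -> completeMetricType R} {A : set (chart F)}.
Context {eps' : R} {phi : forall m0 m : M, F m0 -> F m}.
Context {psi : forall m0 m : M, F m -> F m0} {eta : R -> R} {eps : R}.
Arguments phi : clear implicits.
Arguments psi : clear implicits.
Hypothesis charts : almost_isometric_charts A U d M1 eps' phi psi eta eps.

Lemma phiK m0 m : M1 m0 -> lball U d m0 eps' m ->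
  cancel (phi m0 m) (psi m0 m) /\ cancel (psi m0 m) (phi m0 m).
Proof.
have [e'0 /(_ m0) C0 _ _ _] := charts => M1m0 [Um dm].
(* Charts are given for radii below [eps']; this midpoint is such a radius and its ball still
   contains [m]. *)
pose e := (d m0 m m0 + eps') / 2.
have e0 : 0 < e < eps'.
  by have := local_dist_ge0 Um; rewrite /e => d0; lra.
have [[_ /(_ m)] + _] := C0 e M1m0 e0.
by apply; split => //=; rewrite /e; lra.
Qed.

Lemma psi_id m0 x : M1 m0 -> psi m0 m0 x = x.
Proof.
have [e'0 _ /(_ m0) phi1 _ _] := charts => M1m0.
have [+ _] := phiK M1m0 (lballxx m0 e'0).
by move=> /(_ x); rewrite phi1.
Qed.

Definition base_chart m0 : chart F :=
  @Chart R M F m0 (lball U d m0 (eps' / 2)) (phi m0) (psi m0).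

Lemma C0_base_chart m0 : M1 m0 -> C0_chart A (base_chart m0).
Proof. by have [e'0 C0 _ _ _] := charts => M1m0; apply: C0 => //; lra. Qed.

Lemma base_chart_center m0 : cdom (base_chart m0) m0.
Proof. by have [e'0 _ _ _ _] := charts; apply: lballxx; lra. Qed.

Lemma near_almost_isometric m0 b : 0 < b -> eps < b -> M1 m0 -> \forall m \near m0,
  [/\ lball U d m0 eps' m, lip_le (1 + b) (phi m0 m) & lip_le (1 + b) (psi m0 m)].
Proof.
move=> b0 epsb M1m0; have [e'0 _ phi1 lips [_ eta0]] := charts.
have [r r0 etar] := limf_esup_right_bound eta0 epsb.
have := near_lball m0 e'0; have := near_lball m0 r0.
apply: (@filterS2 _ (nbhs m0)) => m [Um dr] e'm; split => //.
(* The limit superior does not control [eta 0], but at the center the chart is the identity. *)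
- have [->|mm0] := eqVneq m m0.
    rewrite phi1// => x y; rewrite ler_peMl ?mdist_ge0//; lra.
  move=> x y; apply: le_trans ((lips m0 m M1m0 e'm).1 x y) _.
  rewrite ler_wpM2r ?mdist_ge0// lerD2l etar//.
  by rewrite lt0r local_dist_ge0// andbT; apply: contra_neq mm0; exact: local_dist_eq0.
- have [->|mm0] := eqVneq m m0.
    move=> x y; rewrite !psi_id// ler_peMl ?mdist_ge0//; lra.
  move=> x y; apply: le_trans ((lips m0 m M1m0 e'm).2 x y) _.
  rewrite ler_wpM2r ?mdist_ge0// lerD2l etar//.
  by rewrite lt0r local_dist_ge0// andbT; apply: contra_neq mm0; exact: local_dist_eq0.
Qed.

Context {h hinv : M -> M} {f : forall m, F m -> F (h m)}.
Arguments f : clear implicits.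
Hypothesis atlasA : bundle_atlas A.
Hypothesis C0h : C0_invertible M1 h hinv.
Context {sigma : forall m, F m}.
Arguments sigma : clear implicits.
Hypothesis f_sigma : invariant_section M1 f sigma.

Lemma M1_hinv m : M1 (hinv m). Proof. by have [] := C0h. Qed.

Lemma hinvK : cancel hinv h. Proof. by have [] := C0h. Qed.

(* Writing the fiber over [m] as the fiber over [h (hinv m)] avoids transports. *)
Lemma psi_section m0 m :
  psi m0 m (sigma m) = psi m0 (h (hinv m)) (f (hinv m) (sigma (hinv m))).
Proof. by rewrite f_sigma ?hinvK//; exact: M1_hinv. Qed.

(** Continuity of [f] is relative to the part over [M1], where all values of [p] lie. *)
Lemma bundle_map_cvg m0 (p : M -> total_space A) :
  C0_bundle_map A M1 f -> (forall m, M1 (total_proj (p m))) ->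
  {for m0, continuous p} -> {for m0, continuous (bundle_map f \o p)}.
Proof.
move=> /subspace_continuousP cf M1p cp.
move=> W nW.
have nfW : nbhs (p m0) [set x | M1 (total_proj x) -> W (bundle_map f x)].
  exact: cf (p m0) (M1p m0) W nW.
by apply: (@filterS _ (nbhs m0)) (cp _ nfW) => m /=; exact.
Qed.

Lemma section_mapE :
  section_map A sigma = bundle_map f \o (section_map A sigma \o hinv).
Proof.
apply: functional_extensionality_dep => m.
rewrite /bundle_map /section_map /= f_sigma ?hinvK//; exact: M1_hinv.
Qed.

(** Interpolate through the image under [f] of the point over [hinv m] with the same coordinate as
    [sigma (hinv m0)]. One piece is below [e] by continuity of [f]; the other passes through [phi],
    [f] and [psi], with factors [1 + b], [q] and [1 + b]. *)
Lemma oscillation_step m0 b q e :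
  C0_bundle_map A M1 f -> 0 < b -> eps < b ->
  (forall m, M1 m -> lip_le q (f m)) -> 0 <= q -> M1 m0 -> 0 < e ->
  \forall m \near m0,
    mdist (psi m0 m (sigma m)) (psi m0 m0 (sigma m0)) <=
    (1 + b) * (q * ((1 + b) *
      mdist (psi (hinv m0) (hinv m) (sigma (hinv m)))
            (psi (hinv m0) (hinv m0) (sigma (hinv m0))))) + e.
Proof.
move=> cf b0 epsb lipf q0 M1m0 e0; set n0 := hinv m0.
have M1n0 : M1 n0 by exact: M1_hinv.
have [_ _ phi1 _ _] := charts.
have [_ _ _ _ hinv_cont] := C0h.
(* The section with constant coordinate [sigma n0] in the chart at [n0], evaluated at [hinv m]. *)
pose p m : total_space A := in_fiber A (phi n0 (hinv m) (sigma n0)).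
have p_cont : {for m0, continuous p}.
  have ct := chart_continuous_at (c := base_chart n0) (x := sigma n0) atlasA
    (C0_base_chart M1n0) (base_chart_center n0).
  have pair_cvg : (hinv m, sigma n0) @[m --> m0] --> (n0, sigma n0).
    by apply: cvg_pair; [exact: hinv_cont|exact: cvg_cst].
  exact: (cvg_comp _
    (fun p => in_fiber A (cmap (base_chart n0) p.1 p.2)) pair_cvg ct).
have M1p m : M1 (total_proj (p m)) by exact: M1_hinv.
have fp_cont := bundle_map_cvg cf M1p p_cont.
have dom0 : cdom (base_chart m0) (total_proj ((bundle_map f \o p) m0)).
  by rewrite /total_proj /= hinvK; exact: base_chart_center.
have coord_cont := chart_coordinate_continuous_at atlasA (C0_base_chart M1m0) dom0.
have /metricType_numDomainType.cvgr_dist_lt/(_ e e0) near_e :=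
  cvg_comp _ (fun p : total_space A => psi m0 (projT1 p) (projT2 p))
    fp_cont coord_cont.
have near_m0 := near_almost_isometric b0 epsb M1m0.
have near_n0 := hinv_cont m0 _ (near_almost_isometric b0 epsb M1n0).
near=> m.
have [_ _ lip_psi] : [/\ lball U d m0 eps' m, lip_le (1 + b) (phi m0 m)
  & lip_le (1 + b) (psi m0 m)] by near: m.
have [n0m lip_phi _] : [/\ lball U d n0 eps' (hinv m),
  lip_le (1 + b) (phi n0 (hinv m)) & lip_le (1 + b) (psi n0 (hinv m))] by near: m.
have em : mdist (psi m0 (h n0) (f n0 (phi n0 n0 (sigma n0))))
  (psi m0 (h (hinv m)) (f (hinv m) (phi n0 (hinv m) (sigma n0)))) < e.
  by near: m.
rewrite (le_trans (metric_triangle _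
  (psi m0 (h (hinv m)) (f (hinv m) (phi n0 (hinv m) (sigma n0)))) _))//.
apply: lerD; last first.
  by rewrite metric_sym psi_section ltW//; move: em; rewrite phi1.
rewrite psi_section; rewrite -[in lip_le _ (psi m0 m)](hinvK m) in lip_psi.
rewrite (le_trans (lip_psi _ _))// ler_wpM2l//; first lra.
rewrite (le_trans (lipf _ _ _ _))//; first exact: M1_hinv.
rewrite ler_wpM2l// psi_id//.
rewrite -{1}((phiK M1n0 n0m).2 (sigma (hinv m))).
exact: lip_phi.
Unshelve. all: by end_near. Qed.

(** Each step pulls the neighborhood obtained at [hinv m0] back by the continuous [hinv], so the
    neighborhood depends on [n]. The inherited error [e / 2] is multiplied by [r < 1], leaving room
    for the new [e / 2]. *)
Lemma oscillation_bound b q B n m0 e :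
  C0_bundle_map A M1 f -> 0 < b -> eps < b ->
  (forall m, M1 m -> lip_le q (f m)) -> 0 <= q -> (1 + b) * (q * (1 + b)) < 1 ->
  (forall m (x y : F m), mdist x y <= B) -> M1 m0 -> 0 < e ->
  \forall m \near m0, mdist (psi m0 m (sigma m)) (psi m0 m0 (sigma m0)) <=
    ((1 + b) * (q * (1 + b))) ^+ n * B + e.
Proof.
move=> cf b0 epsb lipf q0; set r := (1 + b) * (q * (1 + b)) => r1 diamF.
have r0 : 0 <= r by rewrite /r !mulr_ge0//; lra.
elim: n m0 e => [|n IH] m0 e M1m0 e0.
  near=> m; rewrite expr0 mul1r (le_trans (diamF _ _ _))//; lra.
have e2 : 0 < e / 2 by lra.
have [_ _ _ _ hinv_cont] := C0h.
have step := oscillation_step cf b0 epsb lipf q0 M1m0 e2.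
have IHm := hinv_cont m0 _ (IH (hinv m0) _ (M1_hinv m0) e2).
near=> m.
have step_m : mdist (psi m0 m (sigma m)) (psi m0 m0 (sigma m0)) <=
    (1 + b) * (q * ((1 + b) *
      mdist (psi (hinv m0) (hinv m) (sigma (hinv m)))
            (psi (hinv m0) (hinv m0) (sigma (hinv m0))))) + e / 2 by near: m.
have IH_m : mdist (psi (hinv m0) (hinv m) (sigma (hinv m)))
    (psi (hinv m0) (hinv m0) (sigma (hinv m0))) <= r ^+ n * B + e / 2.
  by near: m.
rewrite (le_trans step_m)// exprS.
move: (mdist _ _) IH_m => D /(ler_wpM2l r0).
rewrite (_ : (1 + b) * (q * ((1 + b) * D)) = r * D); last by rewrite /r; ring.
move: (r ^+ n) => rn rD.
have : r * (e / 2) <= e / 2 by rewrite ler_piMl// ltW.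
by move: rD; rewrite mulrDr mulrA => ? ?; lra.
Unshelve. all: by end_near. Qed.

Lemma section_continuous b q B :
  C0_bundle_map A M1 f -> 0 < b -> eps < b ->
  (forall m, M1 m -> lip_le q (f m)) -> 0 <= q -> (1 + b) * (q * (1 + b)) < 1 ->
  (forall m (x y : F m), mdist x y <= B) ->
  continuous (section_map A sigma).
Proof.
move=> cf b0 epsb lipf q0 r1 diamF.
have r0 : 0 <= (1 + b) * (q * (1 + b)) by rewrite !mulr_ge0//; lra.
have [_ _ _ _ hinv_cont] := C0h.
have M1_cont m0 : M1 m0 -> {for m0, continuous (section_map A sigma)}.
  move=> M1m0.
  apply: (section_continuous_at atlasA (C0_base_chart M1m0) (base_chart_center m0)).
  apply/metricType_numDomainType.cvgrPdist_lt => e e0 /=.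
  have e2 : 0 < e / 2 by lra.
  have [n _ /(_ n (leqnn n)) /= ne] := expr_bound_eventually_small B r0 r1 e2.
  have := oscillation_bound n cf b0 epsb lipf q0 r1 diamF M1m0 e2.
  apply: (@filterS _ (nbhs m0)) => m Dm.
  by rewrite metric_sym (le_lt_trans Dm)//; lra.
move=> m0; rewrite section_mapE; apply: bundle_map_cvg => //.
  by move=> m; exact: M1_hinv.
apply: continuous_comp; first exact: hinv_cont.
by apply: M1_cont; exact: M1_hinv.
Qed.

(** Both local representatives are taken at the coordinate of [sigma (hinv m)]. The remaining
    comparison takes place over [m0], where the charts at [m0] and [hinv m0] are centered and hence
    isometric, so only [l] appears. *)
Lemma section_recursion (eps1 L l : R) (mu : M -> R) m0 m :
  (forall m0 m, M1 m0 ->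
    lball U d m0 ((mu m0)^-1 * eps1) m ->
    lball U d m0 eps' m -> lball U d (hinv m0) eps' (hinv m) ->
    forall x : F (hinv m0),
      mdist (local_rep_map phi psi hinv f m0 m x)
            (local_rep_map phi psi hinv f m0 m0 x) <= L * d m0 m m0) ->
  lip_le l (f (hinv m0)) -> M1 m0 ->
  lball U d m0 ((mu m0)^-1 * eps1) m -> lball U d m0 eps' m ->
  lball U d (hinv m0) eps' (hinv m) ->
  mdist (psi m0 m (sigma m)) (psi m0 m0 (sigma m0)) <= L * d m0 m m0 +
    l * mdist (psi (hinv m0) (hinv m) (sigma (hinv m)))
              (psi (hinv m0) (hinv m0) (sigma (hinv m0))).
Proof.
move=> rep_lip lipf M1m0 mum e'm e'n; set n0 := hinv m0.
have M1n0 : M1 n0 by exact: M1_hinv.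
have [_ _ phi1 _ _] := charts.
(* Stated for any [k] equal to [m0], so as to apply over [h n0] without transport. *)
have psi_isom k (e : k = m0) (x y : F k) :
    mdist (psi m0 k x) (psi m0 k y) = mdist x y.
  by move: x y; rewrite e => x y; rewrite !psi_id.
have := rep_lip m0 m M1m0 mum e'm e'n (psi n0 (hinv m) (sigma (hinv m))).
rewrite /local_rep_map (phiK M1n0 e'n).2 -psi_section phi1// => rep_m.
rewrite (le_trans (metric_triangle _ _ _) (lerD rep_m _))//.
by rewrite (psi_section m0 m0) psi_isom ?hinvK// -/n0 [psi n0 n0 _]psi_id.
Qed.

End invariant_sections.

(** * Real bounds from extended suprema, and the choice of constants *)

Lemma ereal_sup_lt_bound (R : realType) (T : Type) (D : set T) (g : T -> R)
    (x : \bar R) : (ereal_sup [set (g t)%:E | t in D] < x)%E ->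
  exists2 b : R, (b%:E < x)%E & forall t, D t -> g t <= b.
Proof.
have ub t : D t -> ((g t)%:E <= ereal_sup [set (g t)%:E | t in D])%E.
  by move=> Dt; apply: ereal_sup_ubound; exists t.
case: (ereal_sup _) ub => [b||] ub bx; first by exists b.
  by move: bx; rewrite ltNge leey.
(* A supremum equal to [-oo] means that [D] is empty, so any real below [x] serves. *)
have D0 t : D t -> False by move=> /ub; rewrite leeNy_eq.
case: x bx => // [r|] _.
  by exists (r - 1) => [|t /D0//]; rewrite lte_fin; lra.
by exists 0 => [|t /D0//]; rewrite ltry.
Qed.

Lemma mdist_le_of_diam (R : realType) (T : Type) (F : T -> metricType R) :
  (ereal_sup [set diam (F t) | t in [set: T]] < +oo)%E ->
  exists2 B, 0 <= B & forall t (x y : F t), mdist x y <= B.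
Proof.
have ub t (x y : F t) :
    ((mdist x y)%:E <= ereal_sup [set diam (F t) | t in [set: T]])%E.
  apply: (@le_trans _ _ (diam (F t))); last first.
    by apply: ereal_sup_ubound; exists t.
  by apply: ereal_sup_ubound; exists (x, y).
case: (ereal_sup _) ub => [b|//|] ub _.
  exists (Num.max b 0) => [|t x y]; first by rewrite le_max lexx orbT.
  by rewrite le_max -lee_fin ub.
by exists 0 => // t x y; have := ub t x y; rewrite leeNy_eq.
Qed.

Theorem theorem7p1 (R : realType) (lambda_bar : R) (hlb : lambda_bar < 1) :
  exists eps0 : R, 0 < eps0 /\
  forall (M : topologicalType) (U : M -> set M) (d : M -> M -> M -> R)
    (M1 : set M) (F : M -> completeMetricType R) (A : set (chart F))
    (eps' : R) (phi : forall m0 m : M, F m0 -> F m)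
    (psi : forall m0 m : M, F m -> F m0) (eta : R -> R) (eps : R)
    (h hinv : M -> M) (eps1 : R) (mu : M -> R)
    (f : forall m, F m -> F (h m)) (lambda : M -> R),
  0 < eps -> eps < eps0 ->
  locally_metrized U d ->
  bundle_atlas A ->
  range (@total_proj R M F A) = [set: M] ->
  almost_isometric_charts A U d M1 eps' phi psi eta eps ->
  C0_invertible M1 h hinv ->
  inverse_locally_lipschitz U d M1 hinv eps1 mu ->
  C0_bundle_map A M1 f ->
  (ereal_sup [set diam (F m) | m in [set: M]] < +oo)%E ->
  (forall m, 0 <= lambda m) ->
  (forall m, M1 m -> lip_le (lambda m) (f m)) ->
  almost_uniformly_continuous_around U d M1 eps lambda ->
  almost_continuous U d eps lambda ->
  (ereal_sup [set (lambda m)%:E | m in [set: M]] <= lambda_bar%:E)%E ->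
  (exists! sigma : forall m, F m, invariant_section M1 f sigma) /\
  forall sigma : forall m, F m, invariant_section M1 f sigma ->
    continuous (section_map A sigma) /\
    forall theta : R, 0 < theta -> theta <= 1 ->
      uniformly_lipschitz_map_around U d M1 eps' phi psi hinv eps1 mu f ->
      (ereal_sup [set (mu m `^ theta * lambda m)%:E | m in [set: M]] < 1)%E ->
      uniformly_holder_section_around U d M1 eps' psi eps1 mu theta sigma.
Proof.
(* [lambda_bar] may be negative, while the contraction rate has to be nonnegative. *)
pose q := Num.max lambda_bar 0.
have q0 : 0 <= q by rewrite le_max lexx orbT.
have q1 : q < 1 by rewrite gt_max hlb ltr01.
(* The distortion is bounded with [b = 2 * eps], strictly above [eps]. As [eps < 1 / 8], the rate
   [q * (1 + b) ^+ 2] is at most [q + 8 * eps], hence below 1. *)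
exists ((1 - q) / 8); split; first lra.
move=> M U d M1 F A eps' phi psi eta eps h hinv eps1 mu f lambda.
move=> eps_gt0 eps_lt Ud atlasA _ charts C0h hinv_lip cf diam_fin lambda0 lipf.
move=> _ _ lambda_sup.
have lambda_q m : lambda m <= q.
  rewrite le_max -lee_fin (le_trans _ lambda_sup)//.
  by apply: ereal_sup_ubound; exists m.
have lip_q m : M1 m -> lip_le q (f m).
  by move=> /lipf lipm x y; rewrite (le_trans (lipm x y))// ler_wpM2r ?mdist_ge0.
have [B B0 diamF] := mdist_le_of_diam diam_fin.
have [M1hinv hK hinvK _ _] := C0h.
split.
  exact: exists_unique_invariant_section q0 q1 M1hinv hK hinvK diamF lip_q.
move=> sigma f_sigma; split.
  apply: (section_continuous Ud charts atlasA C0h f_sigma (b := 2 * eps) cf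
    _ _ lip_q q0 _ diamF); [lra|lra|].
  have : q * eps <= eps by rewrite ler_piMl// ltW.
  by nra.
move=> theta theta0 theta1 [L rep_lip] bunching.
have [eps1_gt0 [mu_ge0 mu_gt0] hinv_lip_at mu_sup] := hinv_lip.
have [eps'_gt0 _ _ _ _] := charts.
have [kappa kappa1 bunch] := ereal_sup_lt_bound bunching.
have [Lambda0 _ mu_le] := ereal_sup_lt_bound mu_sup.
pose Lambda := Num.max Lambda0 1.
have Lambda1 : 1 <= Lambda by rewrite le_max lexx orbT.
have mu_Lambda m : M1 m -> mu m <= Lambda.
  by move=> /mu_le mum; rewrite le_max mum.
(* Below [rho], the three ball conditions of the recursion hold: [Lambda] bounds [mu], and
   [Lambda >= 1] keeps [m] itself in the ball of radius [eps']. *)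
pose rho := Num.min eps' eps1 / Lambda.
have rho0 : 0 < rho by rewrite divr_gt0 ?lt_min ?eps'_gt0//; lra.
have [C C0 CP] : exists2 C, 0 < C & forall m0 m, M1 m0 -> U m0 m ->
    mdist (psi m0 m (sigma m)) (psi m0 m0 (sigma m0)) <=
    C * d m0 m m0 `^ theta.
  apply: (@holder_of_recursion R M U d M1 hinv mu lambda
    (fun m0 m => mdist (psi m0 m (sigma m)) (psi m0 m0 (sigma m0)))
    theta rho (Num.max L 0) B q kappa Lambda) => //.
  - by rewrite le_max lexx orbT.
  - by move=> m M1m; split => //; [exact: mu_Lambda|exact: bunch].
  - by move=> m0 m _; exact: local_dist_ge0.
  move=> m0 m M1m0 Um d_rho.
  have d0 := local_dist_ge0 Ud Um.
  have Lambda_d : Lambda * d m0 m m0 < Num.min eps' eps1.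
    by move: d_rho; rewrite /rho ltr_pdivlMr 1?mulrC//; lra.
  have [d_eps' d_eps1] : Lambda * d m0 m m0 < eps' /\ Lambda * d m0 m m0 < eps1.
    by move: Lambda_d; rewrite lt_min => /andP.
  have mu_d : mu m0 * d m0 m m0 <= Lambda * d m0 m m0.
    by rewrite ler_wpM2r// mu_Lambda.
  have mum : lball U d m0 ((mu m0)^-1 * eps1) m.
    split => //; rewrite ltr_pdivlMl ?mu_gt0//; lra.
  have [image_sub dist_le] := hinv_lip_at m0 M1m0.
  have Uhm : U (hinv m0) (hinv m) by apply: image_sub; exists m.
  have dhm := dist_le m mum.
  have e'm : lball U d m0 eps' m by split => //; nra.
  have e'hm : lball U d (hinv m0) eps' (hinv m) by split => //; lra.
  split => //.
  rewrite (le_trans (section_recursion Ud charts C0h f_sigma rep_lip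
    (lipf _ (M1hinv m0)) M1m0 mum e'm e'hm))// lerD2r ler_wpM2r//.
  by rewrite le_max lexx.
(* The bound [CP] holds on all of [U m0], so the radius 1 is arbitrary. *)
exists C, 1; split => // m0 m M1m0 [Um _] _ _; exact: CP.
Qed.
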